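(* Let $I$ be a non-empty set and let $T$ be a unital non-associative ring. Then the generalized matrix ring $M_I(T)$ is left (respectively right) artinian if and only if $I$ is finite and $T$ is left (respectively right) artinian.
   Context: A ''non-associative ring'' is an additive abelian group with a multiplication distributive over addition, not assumed associative; the identity of a unital ring is assumed non-zero. A ring is left (right) artinian if it satisfies the descending chain condition on left (right) ideals (additive subgroups closed under left (right) multiplication by all ring elements). The generalized matrix ring $M_I(T)$ is the groupoid ring over $T$ of the groupoid with object set $I$ and exactly one morphism $(i,j)$ from $j$ to $i$ for all $i,j\in I$, with composition $(i,j)(j,k)=(i,k)$. That is, it consists of finite formal sums $\sum_{i,j\in I} t_{ij}\,\delta_{(i,j)}$ with $t_{ij}\in T$ (i.e. $I\times I$-matrices over $T$ with only finitely many non-zero entries), with componentwise addition and multiplication determined by $(t\,\delta_{(i,j)})(t'\,\delta_{(k,l)})=tt'\,\delta_{(i,l)}$ if $j=k$ and $0$ otherwise. *)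

(* Defs.v *)
From HB Require Import structures.
From mathcomp Require Import all_boot all_order all_algebra finmap.
From mathcomp.multinomials Require Import monalg.
From mathcomp Require Import classical_sets cardinality.

Set Implicit Arguments.
Unset Strict Implicit.
Unset Printing Implicit Defensive.

Import GRing.Theory.

Local Open Scope ring_scope.

(* The product of a non-associative ring is the [magmaType] product, written
   [(x * y)%g], and its identity, if any, is [1%g]: the product of [ring_scope]
   belongs to associative unital rings. *)
HB.mixin Record Zmodule_isNaRing R of Magma R & GRing.Zmodule R := {
  namulDl : left_distributive (fun x y : R => (x * y)%g) +%R;
  namulDr : right_distributive (fun x y : R => (x * y)%g) +%R
}.

#[short(type="naRingType")]
HB.structure Definition NaRing :=
  {R of Zmodule_isNaRing R & Magma R & GRing.Zmodule R}.

HB.mixin Record NaRing_isNonZero R of UMagma R & NaRing R := {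
  naoner_neq0 : (1%g : R) != 0
}.

#[short(type="unitalNaRingType")]
HB.structure Definition UnitalNaRing :=
  {R of NaRing_isNonZero R & UMagma R & NaRing R}.

Section Artinian.
Local Open Scope classical_set_scope.
Context (R : naRingType).

Definition additive_subgroup (J : set R) : Prop :=
  J 0 /\ forall x y, J x -> J y -> J (x - y).

Definition left_ideal (J : set R) : Prop :=
  additive_subgroup J /\ forall r x, J x -> J (r * x)%g.

Definition right_ideal (J : set R) : Prop :=
  additive_subgroup J /\ forall r x, J x -> J (x * r)%g.

Definition descending_chain_condition (P : set R -> Prop) : Prop :=
  forall J : nat -> set R,
    (forall n, P (J n)) -> (forall n, J n.+1 `<=` J n) ->
    exists N, forall n, (N <= n)%N -> J n = J N.

Definition left_artinian : Prop := descending_chain_condition left_ideal.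
Definition right_artinian : Prop := descending_chain_condition right_ideal.

End Artinian.

Section NaRingTheory.
Context (R : naRingType).

Lemma namul0r (x : R) : (0 * x)%g = 0.
Proof. by apply: (@addrI _ (0 * x)%g); rewrite -namulDl !addr0. Qed.

Lemma namulr0 (x : R) : (x * 0)%g = 0.
Proof. by apply: (@addrI _ (x * 0)%g); rewrite -namulDr !addr0. Qed.

End NaRingTheory.

(* [{malg T[I * I]}] is the group of finite formal sums; its element
   [<< t *g (i, j) >>] is the sum with the single term t delta_(i,j), and
   [f@_(i, j)] is the coefficient of f at (i,j). *)
Definition gmatrix (I : choiceType) (T : zmodType) : Type := {malg T[(I * I)%type]}.

HB.instance Definition _ (I : choiceType) (T : zmodType) :=
  GRing.Zmodule.on (gmatrix I T).

Section GenMx.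
Context (I : choiceType) (T : naRingType).
Implicit Types f g h : gmatrix I T.

Definition gmatrix_mul f g : gmatrix I T :=
  \sum_(p <- msupp f) \sum_(q <- msupp g)
    if p.2 == q.1 then << (f@_p * g@_q)%g *g (p.1, q.2) >> else 0.

Lemma gmatrix_mulw (d1 d2 : {fset I * I}) f g :
  (msupp f `<=` d1)%fset -> (msupp g `<=` d2)%fset ->
  gmatrix_mul f g = \sum_(p <- d1) \sum_(q <- d2)
    if p.2 == q.1 then << (f@_p * g@_q)%g *g (p.1, q.2) >> else 0.
Proof.
move=> le_d1 le_d2; rewrite /gmatrix_mul (big_fset_incl _ le_d1) /=.
  apply/eq_bigr=> p _; apply/big_fset_incl => // q _ /mcoeff_outdom ->.
  by rewrite namulr0 monalgU0 if_same.
move=> p _ /mcoeff_outdom fp.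
by rewrite big1 => // q _; rewrite fp namul0r monalgU0 if_same.
Qed.

Lemma gmatrix_mulDl : left_distributive gmatrix_mul +%R.
Proof.
move=> f g h; set d := (msupp f `|` msupp g)%fset.
rewrite (@gmatrix_mulw d (msupp h) (f + g)%R) ?msuppD_le //.
rewrite (@gmatrix_mulw d (msupp h) f) ?fsubsetUl //.
rewrite (@gmatrix_mulw d (msupp h) g) ?fsubsetUr //.
rewrite -big_split /=; apply/eq_bigr=> p _.
rewrite -big_split /=; apply/eq_bigr=> q _.
by case: ifP => _; rewrite ?addr0 // mcoeffD namulDl monalgUD.
Qed.

Lemma gmatrix_mulDr : right_distributive gmatrix_mul +%R.
Proof.
move=> h f g; set d := (msupp f `|` msupp g)%fset.
rewrite (@gmatrix_mulw (msupp h) d h (f + g)%R) ?msuppD_le //.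
rewrite (@gmatrix_mulw (msupp h) d h f) ?fsubsetUl //.
rewrite (@gmatrix_mulw (msupp h) d h g) ?fsubsetUr //.
rewrite -big_split /=; apply/eq_bigr=> p _.
rewrite -big_split /=; apply/eq_bigr=> q _.
by case: ifP => _; rewrite ?addr0 // mcoeffD namulDr monalgUD.
Qed.

HB.instance Definition _ := hasMul.Build (gmatrix I T) gmatrix_mul.
HB.instance Definition _ :=
  Zmodule_isNaRing.Build (gmatrix I T) gmatrix_mulDl gmatrix_mulDr.

Lemma gmatrix_mulUU (i j k l : I) (t t' : T) :
  ((<< t *g (i, j) >> : gmatrix I T) * << t' *g (k, l) >>)%g =
  if j == k then << (t * t')%g *g (i, l) >> else 0.
Proof.
rewrite [LHS](gmatrix_mulw msuppU_le msuppU_le) !big_seq_fset1 /=.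
by rewrite !mcoeffUU.
Qed.

End GenMx.

(* Main.v *)
Require Import Defs.
From HB Require Import structures.
From mathcomp Require Import finmap.
From mathcomp.multinomials Require Import monalg.
From mathcomp Require Import all_boot all_algebra.
From mathcomp Require Import boolp classical_sets functions cardinality.

(** If I is infinite, the matrices vanishing on the first n columns of a sequence
    of distinct columns form a strictly decreasing chain of left ideals of M_I(T).
    A left ideal L of T is recovered from the left ideal of matrices with entries
    in L.  Conversely, let I be finite and T left artinian: a chain of left ideals
    stabilizes by induction on the number of columns in which its members may be
    nonzero, because it does so as soon as the entries in one column, which form
    a chain of left ideals of T, and the members vanishing in that column do.
    The right-handed statement follows by transposition, an anti-isomorphism from
    M_I(T) to the matrix ring over the opposite ring of T. *)

Import GRing.Theory.

Set Implicit Arguments.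
Unset Strict Implicit.
Unset Printing Implicit Defensive.

Local Open Scope classical_set_scope.
Local Open Scope ring_scope.

(** * Sums, ideals and chains in non-associative rings *)

Section NaRingSum.
Context (R : naRingType) (A : Type).
Implicit Types (s : seq A) (P : pred A) (F : A -> R) (x : R).

Lemma namul_suml s P F x :
  ((\sum_(a <- s | P a) F a) * x)%g = \sum_(a <- s | P a) (F a * x)%g.
Proof.
by apply: (big_morph (fun y => (y * x)%g)) => [y z|]; rewrite ?namulDl ?namul0r.
Qed.

Lemma namul_sumr s P F x :
  (x * (\sum_(a <- s | P a) F a))%g = \sum_(a <- s | P a) (x * F a)%g.
Proof.
by apply: (big_morph (fun y => (x * y)%g)) => [y z|]; rewrite ?namulDr ?namulr0.
Qed.

End NaRingSum.

Lemma additive_subgroupD (R : naRingType) (J : set R) (x y : R) :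
  additive_subgroup J -> J x -> J y -> J (x + y).
Proof.
move=> [J0 JB] Jx Jy; rewrite -[y]opprK; apply: (JB) => //.
by rewrite -[- y]sub0r; apply: JB.
Qed.

Lemma left_idealI (R : naRingType) (J K : set R) :
  left_ideal J -> left_ideal K -> left_ideal (J `&` K).
Proof.
move=> [[J0 JB] JM] [[K0 KB] KM].
split=> [|r x [Jx Kx]]; last by split; [apply: JM | apply: KM].
by split=> // x y [Jx Kx] [Jy Ky]; split; [apply: JB | apply: KB].
Qed.

Lemma nonincreasing_chain (A : Type) (J : nat -> set A) :
  (forall n, J n.+1 `<=` J n) -> forall m n, (m <= n)%N -> J n `<=` J m.
Proof.
move=> dJ m n; elim: n => [|n IH]; first by rewrite leqn0 => /eqP->.
rewrite leq_eqVlt => /orP[/eqP-> //|]; rewrite ltnS => mn.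
exact: subset_trans (dJ n) (IH mn).
Qed.

(** Preimages of left ideals are left ideals, and by surjectivity a subset of [S] is determined by
    its preimage. *)
Lemma left_artinian_epi (R S : naRingType) (phi : R -> S) :
  {morph phi : x y / x - y} -> {morph phi : x y / (x * y)%g} ->
  (forall y, exists x, phi x = y) -> left_artinian R -> left_artinian S.
Proof.
move=> phiB phiM phi_surj artR J idJ dJ.
have phi0 : phi 0 = 0 by rewrite -(subr0 0) phiB subrr.
have [n|n x|N JN] := artR (fun n => phi @^-1` J n).
- have [[J0 JB] JM] := idJ n.
  split=> [|r x] /=; last by rewrite phiM; apply: JM.
  split=> [|x y] /=; first by rewrite phi0.
  by rewrite phiB; apply: JB.
- exact: dJ.
exists N => n /JN eqJ; apply/seteqP.
by split=> y; have [x <-] := phi_surj y;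
  move/seteqP: eqJ => [+ +] => /(_ x) + /(_ x).
Qed.

(** * The opposite ring and transposition *)

Definition naconverse (T : Type) : Type := T.

Section Converse.

HB.instance Definition _ (T : zmodType) := GRing.Zmodule.on (naconverse T).

Context (T : naRingType).

HB.instance Definition _ :=
  hasMul.Build (naconverse T) (fun x y : T => (y * x)%g).
HB.instance Definition _ := Zmodule_isNaRing.Build (naconverse T)
  (fun x y z : T => namulDr z x y) (fun x y z : T => namulDl y z x).

(** The two sides are convertible: the left ideals of the opposite ring unfold to the right ideals
    of [T]. *)
Lemma left_artinian_converse : left_artinian (naconverse T) = right_artinian T.
Proof. by []. Qed.

End Converse.

HB.instance Definition _ (T : unitalNaRingType) :=
  Magma_isUMagma.Build (naconverse T)
    (fun x : T => mulg1 x) (fun x : T => mul1g x).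
HB.instance Definition _ (T : unitalNaRingType) :=
  NaRing_isNonZero.Build (naconverse T) (@naoner_neq0 T).

(** Only the additive group of coefficients is involved, so the same map serves over [T] and over
    [naconverse T]. *)
Definition gmatrix_tr (I : choiceType) (V : zmodType) (f : gmatrix I V) :
  gmatrix I V := \sum_(p <- msupp f) << f@_p *g (p.2, p.1) >>.

Section Transpose.
Context (I : choiceType) (V : zmodType).
Implicit Types f g : gmatrix I V.

Lemma gmatrix_trE f i j : (gmatrix_tr f)@_(i, j) = f@_(j, i).
Proof.
rewrite [in RHS](monalgE f) !raddf_sum; apply: eq_bigr => -[a b] _ /=.
by rewrite !mcoeffU !xpair_eqE andbC.
Qed.

Lemma gmatrix_trK : involutive (@gmatrix_tr I V).
Proof. by move=> f; apply/malgP => -[i j]; rewrite !gmatrix_trE. Qed.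

Lemma gmatrix_trB : {morph @gmatrix_tr I V : f g / f - g}.
Proof.
by move=> f g; apply/malgP => -[i j]; rewrite mcoeffB !gmatrix_trE mcoeffB.
Qed.

Lemma gmatrix_trU (t : V) i j :
  gmatrix_tr (<< t *g (i, j) >> : gmatrix I V) = << t *g (j, i) >>.
Proof.
apply/malgP => -[k l].
by rewrite gmatrix_trE !mcoeffU !xpair_eqE andbC.
Qed.

HB.instance Definition _ :=
  GRing.isZmodMorphism.Build _ _ (@gmatrix_tr I V) gmatrix_trB.

End Transpose.

(** * Entries of products *)

Section Entries.
Context (I : choiceType) (T : naRingType).
Implicit Types f g : gmatrix I T.

Lemma gmatrix_mulUE i j t f k l :
  ((<< t *g (i, j) >> : gmatrix I T) * f)%g@_(k, l) =
  if i == k then (t * f@_(j, l))%g else 0.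
Proof.
(* Both sides are additive in [f], which reduces the claim to a single term of [f]. *)
rewrite [in LHS](monalgE f) [in RHS](monalgE f) namul_sumr !raddf_sum namul_sumr.
case: eqP => [->|/eqP neq_ik].
  apply: eq_bigr => -[a b] _ /=; rewrite gmatrix_mulUU mcoeffU xpair_eqE.
  rewrite (eq_sym a j); case: eqP => _; last by rewrite mcoeff0 namulr0.
  by rewrite mcoeffU xpair_eqE eqxx /=; case: eqP; rewrite ?namulr0.
rewrite big1 // => -[a b] _ /=; rewrite gmatrix_mulUU.
by case: ifP => _; rewrite ?mcoeff0 // mcoeffU xpair_eqE (negPf neq_ik).
Qed.

Lemma gmatrix_mulE f g k l :
  (f * g)%g@_(k, l) = \sum_(p <- msupp f | p.1 == k) (f@_p * g@_(p.2, l))%g.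
Proof.
rewrite [in LHS](monalgE f) namul_suml raddf_sum [RHS]big_mkcond /=.
by apply: eq_bigr => -[i j] _; rewrite gmatrix_mulUE.
Qed.

End Entries.

Lemma gmatrix_trM (I : choiceType) (T : naRingType) (f g : gmatrix I T) :
  gmatrix_tr (f * g)%g =
  ((gmatrix_tr g : gmatrix I (naconverse T)) * gmatrix_tr f)%g.
Proof.
rewrite [in LHS](monalgE f) [in LHS](monalgE g) namul_suml raddf_sum.
rewrite [in RHS]/gmatrix_tr namul_sumr.
apply: eq_bigr => -[i j] _; rewrite namul_sumr namul_suml raddf_sum.
apply: eq_bigr => -[k l] _; rewrite !gmatrix_mulUU.
rewrite /= eq_sym; case: ifP => _; last exact: raddf0.
exact: gmatrix_trU.
Qed.

Lemma right_artinian_gmatrix_converse (I : choiceType) (T : naRingType) :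
  right_artinian (gmatrix I T) <-> left_artinian (gmatrix I (naconverse T)).
Proof.
rewrite -left_artinian_converse; split; apply: left_artinian_epi.
- exact: (@gmatrix_trB I T).
- by move=> f g; exact: (@gmatrix_trM I T g f).
- by move=> f; exists (gmatrix_tr f); apply: gmatrix_trK.
- exact: (@gmatrix_trB I T).
(* The product of [naconverse (naconverse T)] is that of [T] by conversion. *)
- by move=> f g; exact: (@gmatrix_trM I (naconverse T) f g).
- by move=> f; exists (gmatrix_tr f); apply: gmatrix_trK.
Qed.

Lemma infinite_setT_inj (A : Type) :
  infinite_set [set: A] -> exists e : nat -> A, injective e.
Proof.
move=> /infiniteP/card_leP/unsquash e.
exists (fun n => set_val (e (to_setT n))) => m n /val_inj.
by move=> /(inj (in_setT _) (in_setT _)) /(congr1 set_val).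
Qed.

(** * The left artinian case *)

Section LeftArtinian.
Context (I : choiceType) (T : unitalNaRingType).
Implicit Types (f g : gmatrix I T) (J : set (gmatrix I T)) (L : set T).

Definition gmatrix_unit (i j : I) : gmatrix I T := << 1%g *g (i, j) >>.

Lemma gmatrix_unitE i j f k l :
  (gmatrix_unit i j * f)%g@_(k, l) = if i == k then f@_(j, l) else 0.
Proof. by rewrite gmatrix_mulUE mul1g. Qed.

Definition zero_column j : set (gmatrix I T) := [set f | forall i, f@_(i, j) = 0].

(** Left multiplication acts on each column separately. *)
Lemma left_ideal_zero_column j : left_ideal (zero_column j).
Proof.
split=> [|g f f0 i]; last by rewrite gmatrix_mulE big1 // => p _; rewrite f0 namulr0.
split=> [i|f g f0 g0 i]; first by rewrite mcoeff0.
by rewrite mcoeffB f0 g0 subrr.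
Qed.

Lemma left_artinian_gmatrix_finite :
  left_artinian (gmatrix I T) -> finite_set [set: I].
Proof.
move=> artM; apply: contrapT => /infinite_setT_inj [e e_inj].
pose J n : set (gmatrix I T) := [set f | forall m, (m < n)%N -> zero_column (e m) f].
have [n|n f Jf m ltmn|N JN] := artM J.
- split=> [|g f Jf m /Jf f0].
    split=> [m _|f g Jf Jg m ltmn]; have [[z0 zB] _] := left_ideal_zero_column (e m).
      exact: z0.
    by apply: zB; [apply: Jf | apply: Jg].
  by have [_] := left_ideal_zero_column (e m); apply.
- by apply: Jf; apply: leqW.
(* This matrix unit separates [J N] from [J N.+1]: its only nonzero column [e N] is first
   constrained in [J N.+1]. *)
have : J N (gmatrix_unit (e N) (e N)).
  move=> m ltmN i; rewrite mcoeffU xpair_eqE.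
  suff /negPf-> : e N != e m by rewrite andbF.
  apply: contraTneq ltmN => eqe.
  by rewrite (e_inj _ _ eqe) ltnn.
rewrite -(JN N.+1) // => /(_ N (ltnSn N) (e N)); rewrite mcoeffUU.
by move/eqP: (@naoner_neq0 T).
Qed.

Definition ideal_matrices L : set (gmatrix I T) :=
  [set f | forall i j, L f@_(i, j)].

Lemma left_ideal_ideal_matrices L : left_ideal L -> left_ideal (ideal_matrices L).
Proof.
move=> [L0B LM]; have [L0 LB] := L0B; split=> [|g f Lf i j].
  split=> [i j|f g Lf Lg i j]; first by rewrite mcoeff0.
  by rewrite mcoeffB; apply: LB.
rewrite gmatrix_mulE; apply: big_ind => [//|x y|p _].
- exact: additive_subgroupD.
- exact: LM.
Qed.

Lemma left_artinian_gmatrix_base :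
  inhabited I -> left_artinian (gmatrix I T) -> left_artinian T.
Proof.
move=> [i0] artM L idL dL.
have LE n t : left_ideal (L n) ->
    L n t <-> ideal_matrices (L n) << t *g (i0, i0) >>.
  move=> [[L0 _] _]; split=> [Lt i j|/(_ i0 i0)]; last by rewrite mcoeffUU.
  by rewrite mcoeffU; case: eqP.
have [n|n f Lf i j|N LN] := artM (ideal_matrices \o L).
- exact: left_ideal_ideal_matrices.
- exact/dL/Lf.
exists N => n /LN /= eqL; apply/seteqP; split=> t /LE Lt; apply/LE => //;
  by [rewrite eqL; apply: Lt | rewrite -eqL; apply: Lt].
Qed.

(** For a left ideal [J] the choice of [i] is immaterial, since multiplying by matrix units on the
    left moves any row to row [i]; one position thus accounts for the whole column. *)
Definition column_entries i j J : set T := [set f@_(i, j) | f in J].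

Lemma left_ideal_column_entries i j J :
  left_ideal J -> left_ideal (column_entries i j J).
Proof.
move=> [[J0 JB] JM]; split=> [|t _ [f Jf <-]].
  split=> [|_ _ [f Jf <-] [g Jg <-]]; first by exists 0; rewrite ?mcoeff0.
  by exists (f - g); [apply: JB | rewrite mcoeffB].
exists ((<< t *g (i, i) >> : gmatrix I T) * f)%g; first exact: JM.
by rewrite gmatrix_mulUE eqxx.
Qed.

Lemma left_ideal_rows i J f : finite_set [set: I] -> left_ideal J ->
  (forall k, J (gmatrix_unit i k * f)%g) -> J f.
Proof.
move=> /finite_fsetP [X XE] [J_subgroup JM] Jf; have [J0 _] := J_subgroup.
have inX k : k \in X by have : [set` X] k by rewrite -XE.
(* Each summand moves row [k] to row [i] and back, which isolates row [k] of [f]. The bracketing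
   keeps both factors acting from the left, as ideal closure requires without associativity. *)
have -> : f = \sum_(k <- X) (gmatrix_unit k i * (gmatrix_unit i k * f))%g.
  apply/malgP => -[k l]; rewrite raddf_sum (big_fsetD1 k) //= big1_fset ?addr0.
    by rewrite !gmatrix_unitE !eqxx.
  by move=> k'; rewrite !inE gmatrix_unitE => /andP[/negPf->].
apply: big_ind => // [x y|k _]; [exact: additive_subgroupD | exact: JM].
Qed.

(** As for a subgroup with the same kernel and image under a homomorphism: an element of [J] is
    corrected by one of [K] until it vanishes in column [j]. *)
Lemma left_ideal_sub_column i j J K : finite_set [set: I] ->
  left_ideal J -> left_ideal K -> K `<=` J ->
  J `&` zero_column j `<=` K -> column_entries i j J `<=` column_entries i j K ->
  J `<=` K.
Proof.
move=> finI idJ idK KJ kerJK entJK f Jf.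
have [[[_ JB] JM] [K_subgroup KM]] := (idJ, idK).
apply: (left_ideal_rows (i := i)) => // k.
set g := (gmatrix_unit i k * f)%g; have Jg : J g by apply: JM.
have [|h Kh hg] := entJK g@_(i, j); first by exists g.
(* Only row [i] of [h] is kept: [g] lives in that row, so the difference then vanishes in all of
   column [j] and not just at [(i, j)]. *)
have Kh' : K (gmatrix_unit i i * h)%g by apply: KM.
rewrite -[g](subrK (gmatrix_unit i i * h)%g); apply: additive_subgroupD => //.
apply: kerJK; split=> [|k']; first by apply: JB => //; apply: KJ.
rewrite mcoeffB [X in _ - X]gmatrix_unitE.
case: (eqVneq i k') => [<-|/negPf ik']; first by rewrite hg subrr.
by rewrite /g gmatrix_unitE ik' subrr.
Qed.

Lemma left_ideal_chain_stationary (J : nat -> set (gmatrix I T)) (s : seq I) :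
  finite_set [set: I] -> inhabited I -> left_artinian T ->
  (forall n, left_ideal (J n)) -> (forall n, J n.+1 `<=` J n) ->
  (forall n j, j \notin s -> J n `<=` zero_column j) ->
  exists N, forall n, (N <= n)%N -> J n = J N.
Proof.
move=> finI [i] artT; elim: s J => [|j s IH] J idJ dJ J_supp.
  (* With no column left, every member of the chain is the zero ideal. *)
  exists 0%N => n _; apply/seteqP.
  have J0 m f : J m f -> f = 0.
    by move=> Jf; apply/malgP => -[k l]; rewrite (J_supp m l) // mcoeff0.
  by split=> f /J0 ->; case: (idJ 0%N) (idJ n) => [[? _] _] [[? _] _].
(* Intersecting with [zero_column j] removes [j] from the list of admissible columns. *)
have [n|n f [Jf f0]|n l ls f [Jf f0]|N1 kerN1] := IH (fun n => J n `&` zero_column j).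
- exact/left_idealI/left_ideal_zero_column.
- by split=> //; apply: dJ.
- have [->//|lj] := eqVneq l j.
  by apply: (J_supp n l) Jf; rewrite inE negb_or lj.
have [n|n _ [f Jf <-]|N2 entN2] := artT (fun n => column_entries i j (J n)).
- exact: left_ideal_column_entries.
- by exists f => //; apply: dJ.
exists (maxn N1 N2) => n; rewrite geq_max => /andP[N1n N2n].
have N1N := leq_maxl N1 N2; have N2N := leq_maxr N1 N2.
have dJN : J n `<=` J (maxn N1 N2).
  by apply: (nonincreasing_chain dJ); rewrite geq_max N1n.
apply/seteqP; split=> //; apply: (left_ideal_sub_column (i := i) (j := j)) => //.
  by rewrite (kerN1 _ N1N) -(kerN1 n N1n) => f [].
by rewrite (entN2 _ N2N) (entN2 n N2n).
Qed.

Lemma left_artinian_gmatrix : inhabited I ->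
  left_artinian (gmatrix I T) <-> finite_set [set: I] /\ left_artinian T.
Proof.
move=> hI; split=> [artM|[finI artT] J idJ dJ].
  split; first exact: left_artinian_gmatrix_finite.
  exact: left_artinian_gmatrix_base.
have [s sE] := (finite_seqP _).1 finI.
(* Since [s] lists all of [I], the condition on columns outside [s] is vacuous. *)
apply: (left_ideal_chain_stationary (s := s)) => // n j.
by have -> : j \in s by have : [set` s] j by rewrite -sE.
Qed.

End LeftArtinian.

Theorem corollary4p2 (I : choiceType) (T : unitalNaRingType) (hI : inhabited I) :
  (left_artinian (gmatrix I T) <-> finite_set [set: I] /\ left_artinian T) /\
  (right_artinian (gmatrix I T) <-> finite_set [set: I] /\ right_artinian T).
Proof.
split; first exact: left_artinian_gmatrix.
apply: iff_trans (right_artinian_gmatrix_converse I T) _.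
rewrite -left_artinian_converse.
exact: left_artinian_gmatrix.
Qed.
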